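(* Let $A\in\mathbb{R}^{m\times n}$, and let $f:\mathbb{R}_+^n\to\mathbb{R}$ be increasing in each argument. Suppose that $H\in\mathbb{R}^{n\times m}$ is an optimal solution of the problem $$\min\{\, f(\|H_{1\cdot}\|_2,\|H_{2\cdot}\|_2,\ldots,\|H_{n\cdot}\|_2)\;:\; H\in\mathbb{R}^{n\times m},\ AHA=A\,\}.$$ Then $HAH=H$ and $(AH)^{\top}=AH$.
   Context: $H_{i\cdot}$ denotes the $i$-th row of $H$, $\|\cdot\|_2$ is the Euclidean norm, and $\mathbb{R}_+$ is the set of non-negative reals. ''Increasing in each argument'' means strictly increasing in each argument when the other arguments are held fixed (as distinguished from non-decreasing). *)

(* Defs.v *)
From mathcomp Require Import all_boot all_order all_algebra.
From mathcomp Require Import interval_inference reals.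

Set Implicit Arguments.
Unset Strict Implicit.
Unset Printing Implicit Defensive.

Import Order.TTheory GRing.Theory Num.Theory.

Local Open Scope ring_scope.

(* The library's norm on matrices is the sup norm, hence this definition.
   The value lives in {nonneg R}, so that it can be fed to a function whose
   domain is the nonnegative orthant. *)
Definition norm2 (R : realType) (m : nat) (v : 'rV[R]_m) : {nonneg R} :=
  (Num.sqrt (\sum_(j < m) v 0 j ^+ 2))%:nng.

Definition row_norms (R : realType) (n m : nat) (H : 'M[R]_(n, m)) :
  'rV[{nonneg R}]_n := \row_(i < n) norm2 (row i H).

Definition increasing_each_arg (R : realType) (n : nat)
    (f : 'rV[{nonneg R}]_n -> R) : Prop :=
  forall (i : 'I_n) (x y : 'rV[{nonneg R}]_n),
    (forall j : 'I_n, j != i -> x 0 j = y 0 j) ->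
    (x 0 i)%:num < (y 0 i)%:num ->
    f x < f y.

Definition minimizer_on (R : realType) (T : Type) (g : T -> R)
    (C : T -> Prop) (x : T) : Prop :=
  C x /\ forall y : T, C y -> g x <= g y.

(* Main.v *)
(* Let P be the orthogonal projection onto the column space of A. Replacing a
   single row h of H by h P leaves H A, hence feasibility, unchanged, and
   shortens that row unless h P = h. Optimality therefore forces H P = H. Since
   P = A Y for some Y, we get A H = A H A Y = A Y = P, which is symmetric, and
   H A H = H P = H. *)
Require Import Defs.
From mathcomp Require Import all_boot all_order all_algebra.
From mathcomp Require Import interval_inference reals.

Set Implicit Arguments.
Unset Strict Implicit.
Unset Printing Implicit Defensive.

Import Order.TTheory GRing.Theory Num.Theory.

Local Open Scope ring_scope.

Section OrthogonalProjection.
Variable F : realFieldType.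

Lemma dot_row_ge0 (m : nat) (v : 'rV[F]_m) : 0 <= (v *m v^T) 0 0.
Proof. by rewrite mxE sumr_ge0// => j _; rewrite mxE -expr2 sqr_ge0. Qed.

Lemma dot_row_eq0 (m : nat) (v : 'rV[F]_m) : (v *m v^T) 0 0 = 0 -> v = 0.
Proof.
rewrite mxE => /eqP; rewrite psumr_eq0 => [/allP v0|j _]; last first.
  by rewrite mxE -expr2 sqr_ge0.
apply/rowP => j; have := v0 j (mem_index_enum j).
by rewrite !mxE -expr2 sqrf_eq0 => /eqP.
Qed.

(** If [x *m (B *m B^T) = 0], then multiplying by [x^T] gives [x *m B] squared norm zero, so
    [x *m B = 0] and row freeness gives [x = 0]. This is applied to each row of the kernel
    matrix. *)
Lemma gram_unitmx (m r : nat) (B : 'M[F]_(r, m)) :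
  row_free B -> B *m B^T \in unitmx.
Proof.
move=> freeB; rewrite -row_free_unit -kermx_eq0; apply/eqP/row_matrixP => i.
rewrite row0; apply: (row_free_inj freeB); rewrite mul0mx; apply: dot_row_eq0.
rewrite trmx_mul mulmxA -(mulmxA (row i _) B) -row_mul mulmx_ker.
by rewrite row0 mul0mx mxE.
Qed.

(** A full-rank factorization [A = B *m C] makes the Gram matrix of the columns of [B] invertible
    even when [A] is rank deficient. *)
Lemma orthogonal_projection (m n : nat) (A : 'M[F]_(m, n)) :
  exists P : 'M[F]_m,
    [/\ P^T = P, P *m A = A & exists Y : 'M[F]_(n, m), P = A *m Y].
Proof.
have [r [B [C [freeB /row_freeP[D CD] ->]]]] : exists r (B : 'M[F]_(m, r))
    (C : 'M[F]_(r, n)), [/\ row_free B^T, row_free C & A = B *m C].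
  exists (\rank A), (col_base A), (row_base A).
  by rewrite row_base_free mulmx_base /row_free mxrank_tr; split=> //;
    apply: col_base_full.
set G := B^T *m B.
have Gunit : G \in unitmx by rewrite /G -[X in _ *m X]trmxK gram_unitmx.
have GT : G^T = G by rewrite trmx_mul trmxK.
exists (B *m invmx G *m B^T); split.
- by rewrite !trmx_mul trmxK trmx_inv GT mulmxA.
- by rewrite mulmxA -(mulmxA _ B^T B) mulmxKV.
(* As [D] is a right inverse of [C], [A *m D = B]: the columns of [B] are combinations of those of
   [A]. *)
- exists (D *m invmx G *m B^T).
  by rewrite !mulmxA -(mulmxA B C D) CD mulmx1.
Qed.

(** Pythagoras: the cross terms vanish because [P] is symmetric and idempotent. *)
Lemma dot_row_projection (m : nat) (P : 'M[F]_m) (v : 'rV[F]_m) :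
  P^T = P -> P *m P = P ->
  v *m v^T = (v *m P) *m (v *m P)^T + (v - v *m P) *m (v - v *m P)^T.
Proof.
move=> PT PP; have -> : (v - v *m P)^T = v^T - P *m v^T.
  by rewrite linearB /= trmx_mul PT.
rewrite trmx_mul PT mulmxBl !mulmxBr !mulmxA -!(mulmxA v P P) PP.
by rewrite subrr subr0 addrC subrK.
Qed.

End OrthogonalProjection.

Lemma norm2E (R : realType) (m : nat) (v : 'rV[R]_m) :
  (norm2 v)%:num = Num.sqrt ((v *m v^T) 0 0).
Proof.
rewrite /norm2 /= mxE; congr Num.sqrt.
by apply: eq_bigr => j _; rewrite mxE expr2.
Qed.

Theorem proposition9 (R : realType) (m n : nat) (A : 'M[R]_(m, n))
    (f : 'rV[{nonneg R}]_n -> R) (f_incr : increasing_each_arg f)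
    (H : 'M[R]_(n, m))
    (H_opt : minimizer_on (fun X : 'M[R]_(n, m) => f (row_norms X))
               (fun X : 'M[R]_(n, m) => A *m X *m A = A) H) :
  H *m A *m H = H /\ (A *m H)^T = A *m H.
Proof.
have [AHA Hmin] := H_opt.
have [P [PT PA [Y PY]]] := orthogonal_projection A.
have PP : P *m P = P by rewrite {2}PY mulmxA PA -PY.
suff HP : H *m P = H.
  have AH : A *m H = P by rewrite -HP PY !mulmxA AHA.
  by rewrite -mulmxA AH.
apply/row_matrixP => i; rewrite row_mul; set v := row i H.
apply/esym/eqP; rewrite -subr_eq0; apply: contraT => vP.
pose H' : 'M[R]_(n, m) := \matrix_k (if k == i then v *m P else row k H).
have H'A : H' *m A = H *m A.
  apply/row_matrixP => k; rewrite !row_mul rowK.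
  by case: eqP => [->|//]; rewrite -mulmxA PA.
have := Hmin H' _; rewrite -mulmxA H'A mulmxA => /(_ AHA).
rewrite leNgt => /negP[]; apply: (f_incr i) => [k ki|].
  by rewrite !mxE rowK (negPf ki).
rewrite !mxE rowK eqxx !norm2E.
(* By Pythagoras this is exactly the drop in squared length when [v] becomes [v *m P]. *)
have gt0 : 0 < ((v - v *m P) *m (v - v *m P)^T) 0 0.
  by rewrite lt_def dot_row_ge0 andbT; apply: contraNneq vP => /dot_row_eq0->.
have vv := congr1 (fun M : 'M_1 => M 0 0) (dot_row_projection v PT PP).
have {}vv : (v *m v^T) 0 0 = ((v *m P) *m (v *m P)^T) 0 0 +
    ((v - v *m P) *m (v - v *m P)^T) 0 0 by rewrite vv mxE.
have lt_v : ((v *m P) *m (v *m P)^T) 0 0 < (v *m v^T) 0 0 by rewrite vv ltrDl.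
(* Strict monotonicity of the square root asks for the larger radicand to be positive; it exceeds a
   nonnegative one. *)
by rewrite ltr_sqrt// (le_lt_trans _ lt_v)// dot_row_ge0.
Qed.
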